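(* Let $R$ be a unital commutative ring not of characteristic $2$, let $V$ be a free $R$-module of finite rank, and let $B : V\times V\to R$ be an arbitrary (not necessarily symmetric) non-degenerate bilinear form. Let $Q : V\to R$ be the quadratic form $Q(x)=B(x,x)$. Then the Clifford algebra $C\ell(B,V)$ of the bilinear form $B$ and the Clifford algebra $C\ell(Q,V)$ of the quadratic form $Q$ are isomorphic as $\mathbb{Z}_2$-graded algebras: $$C\ell(B,V)\;\cong\; C\ell(Q,V).$$
   Context: $\mathbb{Z}_2$ denotes the additive group of integers modulo $2$. The Clifford algebra of the quadratic form is $C\ell(Q,V):=T(V)/I_{C\ell}$, where $T(V)$ is the tensor algebra and $I_{C\ell}$ is the two-sided ideal generated by the elements $x\otimes x-Q(x)1$, $x\in V$. It is $\mathbb{Z}_2$-graded by the parity of tensor degree. The Clifford algebra of the bilinear form (Chevalley's construction) is defined as follows. Let $\bigwedge V$ be the Grassmann algebra of $V$, and let $u\mapsto\hat u$ be the grade involution, i.e. the algebra automorphism of $\bigwedge V$ extending $x\mapsto -x$ on $V$. For $x\in V$, the left contraction $x\lrcorner_B\,\cdot : \bigwedge V\to\bigwedge V$ is the $R$-linear map determined by $x\lrcorner_B 1=0$, $x\lrcorner_B y=B(x,y)$ for $y\in V$, and $x\lrcorner_B(u\wedge v)=(x\lrcorner_B u)\wedge v+\hat u\wedge(x\lrcorner_B v)$ for $u,v\in\bigwedge V$. Put $L_x:=x\lrcorner_B\cdot\;+\;x\wedge\cdot\;\in\mathrm{End}_R(\bigwedge V)$; it satisfies $L_x^2=Q(x)\,\mathrm{id}$.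 Then $C\ell(B,V)$ is the unital $R$-subalgebra of $\mathrm{End}_R(\bigwedge V)$ generated by all $L_x$, $x\in V$. It is $\mathbb{Z}_2$-graded: the even (odd) part is spanned by the products of an even (odd) number of operators $L_x$. *)

(* Defs.v *)
From HB Require Import structures.
From mathcomp Require Import all_boot all_algebra.
From mathcomp Require Import finmap.
From mathcomp Require Import monalg.
From mathcomp Require Import boolp classical_sets.

Set Implicit Arguments.
Unset Strict Implicit.
Unset Printing Implicit Defensive.

Import GRing.Theory.
Local Open Scope classical_set_scope.
Local Open Scope ring_scope.

Section Span.
Context (R : pzRingType) (M : lmodType R).

Definition submodule (N : set M) : Prop :=
  N 0 /\ forall a u v, N u -> N v -> N (a *: u + v).

Definition span (S : set M) : set M := smallest submodule S.

End Span.

Lemma linear_prop0 (R : pzRingType) (U W : lmodType R) (f : U -> W) :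
  linear f -> f 0 = 0.
Proof. by move=> /(_ (-1) 0 0); rewrite scaler0 addr0 scaleN1r addNr. Qed.

Lemma linear_propZ (R : pzRingType) (U W : lmodType R) (f : U -> W) :
  linear f -> forall a u, f (a *: u) = a *: f u.
Proof.
by move=> fL a u; have := fL a u 0; rewrite !addr0 (linear_prop0 fL) addr0.
Qed.

(* Parities, i.e. the elements of Z_2, are represented by bool: false is even   *)
(* and true is odd.                                                            *)
Definition parity_products (V : Type) (A : pzRingType) (g : V -> A) (b : bool) :
    set A :=
  [set a | exists s : seq V, odd (size s) = b /\ a = \prod_(x <- s) g x].

Definition two_sided_ideal (A : pzRingType) (I : set A) : Prop :=
  [/\ I 0, forall u v, I u -> I v -> I (u + v)
    & forall u v, I u -> I (v * u) /\ I (u * v)].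

Definition generated_ideal (A : pzRingType) (S : set A) : set A :=
  smallest (@two_sided_ideal A) S.

(* The quotient of an algebra by the two-sided ideal generated by S. It may be *)
(* trivial, so it is only a pzRingType and an lmodType R: an algType R         *)
(* requires 0 != 1.                                                            *)
Section QuotientAlgebra.
Context (R : comNzRingType) (A : algType R) (S : set A).

Lemma generated_idealP : two_sided_ideal (generated_ideal S).
Proof.
split=> [|u v Iu Iv|u v Iu].
- by move=> I [[]].
- by move=> I II; have [[_ ID _] _] := II; apply: ID; [exact: Iu|exact: Iv].
by split=> I II; have [[_ _ IM] _] := II; have [] := IM u v (Iu I II).
Qed.

Definition in_ideal : {pred A} := fun u => `[< generated_ideal S u >].

Lemma in_idealP u : reflect (generated_ideal S u) (u \in in_ideal).
Proof. exact: asboolP. Qed.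

Lemma in_ideal_zmod_closed : zmod_closed in_ideal.
Proof.
have [I0 ID IM] := generated_idealP.
split=> [|u v /in_idealP Iu /in_idealP Iv]; apply/in_idealP => //.
by apply: ID => //; rewrite -mulN1r; exact: (IM _ _ Iv).1.
Qed.

HB.instance Definition _ :=
  GRing.isZmodClosed.Build A in_ideal in_ideal_zmod_closed.

Definition quot_alg : Type := Quotient.quot in_ideal.

HB.instance Definition _ := GRing.Zmodule.on quot_alg.

(* The operations on quot_alg are locked to keep failing conversion tests from *)
(* unfolding them.                                                             *)
Definition qpi : A -> quot_alg :=
  locked (fun u : A => \pi_(Quotient.quot in_ideal)%qT u).
Definition qrepr : quot_alg -> A :=
  locked (fun q : Quotient.quot in_ideal => repr q).

Lemma qreprK q : qpi (qrepr q) = q.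
Proof. by rewrite /qpi /qrepr -!lock; exact: reprK. Qed.

Lemma qpi_eq u v : qpi u = qpi v <-> generated_ideal S (u - v).
Proof.
rewrite /qpi -lock.
split=> [e|/in_idealP e]; [apply/in_idealP|apply/eqP]; last first.
  by rewrite -Quotient.idealrBE.
by rewrite Quotient.idealrBE; apply/eqP.
Qed.

Lemma qpiB : zmod_morphism qpi.
Proof. by rewrite /qpi -lock; exact: (raddfB (\pi_(Quotient.quot in_ideal)%qT)). Qed.

Lemma qpiD u v : qpi (u + v) = qpi u + qpi v.
Proof. by rewrite /qpi -lock; exact: (raddfD (\pi_(Quotient.quot in_ideal)%qT)). Qed.

Lemma qreprE u : generated_ideal S (qrepr (qpi u) - u).
Proof. by apply/qpi_eq; rewrite qreprK. Qed.

Definition qone : quot_alg := qpi 1.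
Definition qmul : quot_alg -> quot_alg -> quot_alg :=
  locked (fun p q => qpi (qrepr p * qrepr q)).
Definition qscale : R -> quot_alg -> quot_alg :=
  locked (fun a q => qpi (a *: qrepr q)).

Lemma qpi_mul u v : qpi (u * v) = qmul (qpi u) (qpi v).
Proof.
have [_ ID IM] := generated_idealP.
rewrite /qmul -lock; apply/esym/qpi_eq; rewrite -[_ * _ as X in X - _](subrK (u * qrepr (qpi v))).
rewrite -mulrBl -addrA -mulrBr.
by apply: ID; [exact: (IM _ _ (qreprE u)).2|exact: (IM _ _ (qreprE v)).1].
Qed.

Lemma qpi_scale a u : qpi (a *: u) = qscale a (qpi u).
Proof.
have [_ ID IM] := generated_idealP.
rewrite /qscale -lock; apply/esym/qpi_eq; rewrite -scalerBr -[_ - _]mul1r scalerAl.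
exact: (IM _ _ (qreprE u)).1.
Qed.

Lemma qmulA : associative qmul.
Proof.
by move=> p q r; rewrite -(qreprK p) -(qreprK q) -(qreprK r) -!qpi_mul mulrA.
Qed.
Lemma qmul1 : left_id qone qmul.
Proof. by move=> p; rewrite -(qreprK p) -qpi_mul mul1r. Qed.
Lemma qmulr1 : right_id qone qmul.
Proof. by move=> p; rewrite -(qreprK p) -qpi_mul mulr1. Qed.
Lemma qmulDl : left_distributive qmul +%R.
Proof.
move=> p q r; rewrite -(qreprK p) -(qreprK q) -(qreprK r).
by rewrite -qpiD -!qpi_mul -qpiD mulrDl.
Qed.
Lemma qmulDr : right_distributive qmul +%R.
Proof.
move=> p q r; rewrite -(qreprK p) -(qreprK q) -(qreprK r).
by rewrite -qpiD -!qpi_mul -qpiD mulrDr.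
Qed.

HB.instance Definition _ :=
  GRing.Zmodule_isPzRing.Build quot_alg qmulA qmul1 qmulr1 qmulDl qmulDr.

Lemma qscaleA a b q : qscale a (qscale b q) = qscale (a * b) q.
Proof. by rewrite -(qreprK q) -!qpi_scale scalerA. Qed.
Lemma qscale1 : left_id 1 qscale.
Proof. by move=> q; rewrite -(qreprK q) -qpi_scale scale1r. Qed.
Lemma qscaleDr : right_distributive qscale +%R.
Proof.
move=> a p q; rewrite -(qreprK p) -(qreprK q).
by rewrite -qpiD -!qpi_scale -qpiD scalerDr.
Qed.
Lemma qscaleDl q : {morph qscale^~ q : a b / a + b}.
Proof. by move=> a b; rewrite -(qreprK q) -!qpi_scale -qpiD scalerDl. Qed.

HB.instance Definition _ := GRing.Zmodule_isLmodule.Build R quot_alg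
  qscaleA qscale1 qscaleDr qscaleDl.

Lemma qpiM u v : qpi (u * v) = qpi u * qpi v.
Proof. exact: qpi_mul. Qed.
Lemma qpi1 : qpi 1 = 1.
Proof. by []. Qed.
Lemma qpiZ a u : qpi (a *: u) = a *: qpi u.
Proof. exact: qpi_scale. Qed.

HB.instance Definition _ := GRing.isZmodMorphism.Build A quot_alg qpi qpiB.
HB.instance Definition _ :=
  GRing.isMonoidMorphism.Build A quot_alg qpi (qpi1, qpiM).
HB.instance Definition _ :=
  GRing.isScalable.Build R A quot_alg *:%R qpi qpiZ.

Lemma quot_scalerAl (a : R) (p q : quot_alg) : a *: (p * q) = (a *: p) * q.
Proof.
by rewrite -(qreprK p) -(qreprK q) -qpiM -!qpiZ -qpiM scalerAl.
Qed.
Lemma quot_scalerAr (a : R) (p q : quot_alg) : a *: (p * q) = p * (a *: q).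
Proof.
by rewrite -(qreprK p) -(qreprK q) -qpiM -!qpiZ -qpiM scalerAr.
Qed.

Lemma qpi_rel s : S s -> qpi s = 0.
Proof.
move=> Ss; rewrite -(raddf0 qpi); apply/qpi_eq; rewrite subr0.
exact: sub_gen_smallest.
Qed.

Section Lift.
Context (C : pzRingType) (f : {rmorphism A -> C}).

Lemma ideal_ker : (forall s, S s -> f s = 0) ->
  forall u, generated_ideal S u -> f u = 0.
Proof.
move=> fS; apply: (@smallest_sub _ _ _ [set u | f u = 0]) => //.
rewrite /mkset /=; split=> [|u v fu fv|u v fu].
- exact: rmorph0.
- by rewrite rmorphD fu fv addr0.
by rewrite !rmorphM fu mulr0 mul0r.
Qed.

Definition quot_lift (q : quot_alg) : C := f (qrepr q).

Hypothesis fS : forall s, S s -> f s = 0.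

Lemma quot_liftE u : quot_lift (qpi u) = f u.
Proof. by apply/eqP; rewrite -subr_eq0 -rmorphB (ideal_ker fS) //; exact: qreprE. Qed.

End Lift.

End QuotientAlgebra.

Lemma malg_scalerAr (R : comNzRingType) (K : monomType) (a : R)
    (u v : {malg R[K]}) : a *: (u * v) = u * (a *: v).
Proof.
have e : malgC a * u = u * malgC a.
  rewrite [LHS]fgmulUg [RHS]fgmulgU; apply: eq_bigr => k _.
  by rewrite mul1m mulm1 mulrC.
by rewrite -(mul_malgC a (u * v)) -(mul_malgC a v) !mulrA e.
Qed.

(* T(V): the free associative R-algebra on the set V (noncommutative           *)
(* polynomials with one indeterminate per vector) modulo the linearity of      *)
(* x |-> 'X_x. Its product is the tensor product.                              *)
Section TensorAlgebra.
Context (R : comNzRingType) (V : lmodType R).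

Definition free_alg : Type := {malg R[{fmonom V}]}.
HB.instance Definition _ := GRing.Lalgebra.on free_alg.

Definition free_gen (x : V) : free_alg := << fmu x >>.

HB.instance Definition _ :=
  GRing.Lalgebra_isAlgebra.Build R free_alg (@malg_scalerAr R {fmonom V}).

Definition linearity_relations : set free_alg :=
  [set t | exists a x y,
     t = free_gen (a *: x + y) - (a *: free_gen x + free_gen y)].

Definition tensor_alg : Type := quot_alg linearity_relations.
HB.instance Definition _ := GRing.PzRing.on tensor_alg.
HB.instance Definition _ := GRing.Lmodule.on tensor_alg.

Lemma tensor_oner_neq0 : (1 : tensor_alg) != 0.
Proof.
pose aug : {rmorphism {malg R[{fmonom V}]} -> R} := mcoeff (@mone {fmonom V}).
apply/eqP => /(congr1 (quot_lift (aug : {rmorphism free_alg -> R}))).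
have fS s : linearity_relations s -> aug s = 0.
  have U1 x : aug (free_gen x) = 0.
    by rewrite /aug /= mcoeffU -val_eqE /= fm1 fmU.
  move=> [a [x [y ->]]]; rewrite rmorphB rmorphD !U1 addr0 sub0r.
  by rewrite /aug /= (mcoeffZ a (free_gen x)) [mcoeff _ _]U1 mulr0 oppr0.
rewrite -(raddf0 (@qpi R free_alg linearity_relations)) -qpi1.
rewrite !quot_liftE // rmorph1 raddf0; exact/eqP/oner_neq0.
Qed.

HB.instance Definition _ :=
  GRing.PzSemiRing_isNonZero.Build tensor_alg tensor_oner_neq0.
HB.instance Definition _ := GRing.Lmodule_isLalgebra.Build R tensor_alg
  (@quot_scalerAl _ _ linearity_relations).
HB.instance Definition _ := GRing.Lalgebra_isAlgebra.Build R tensor_alg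
  (@quot_scalerAr _ _ linearity_relations).

Definition tensor_gen (x : V) : tensor_alg := qpi _ (free_gen x).

Lemma tensor_gen_linear : linear tensor_gen.
Proof.
move=> a x y; apply/eqP; rewrite -subr_eq0; apply/eqP.
have r : linearity_relations
    (free_gen (a *: x + y) - (a *: free_gen x + free_gen y)) by exists a, x, y.
by have := qpi_rel r; rewrite qpiB qpiD qpiZ.
Qed.

Lemma free_algE (g : free_alg) :
  g = \sum_(m <- msupp g) g@_m *: \prod_(x <- fmonom_val m) free_gen x.
Proof.
rewrite [LHS]monalgE; apply: eq_bigr => m _.
have -> : \prod_(x <- fmonom_val m) free_gen x = << m >>.
  case: m => s /=; elim: s => [|x s IH].
    by rewrite big_nil; congr << _ >>; apply: val_inj; rewrite /= fm1.
  rewrite big_cons IH [LHS]fgmulUU mulr1; congr << _ >>; apply: val_inj.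
  by rewrite /= fmM fmU.
by apply/malgP => k; rewrite [in RHS]mcoeffZ !mcoeffU mulr_natr.
Qed.

Lemma tensor_ind (N : set tensor_alg) : submodule N ->
  (forall s : seq V, N (\prod_(x <- s) tensor_gen x)) -> forall t, N t.
Proof.
move=> [N0 NL] Np t; rewrite -(qreprK t) (free_algE (qrepr t)).
elim: (msupp _ : seq _) => [|m r IH]; first by rewrite big_nil raddf0.
rewrite big_cons qpiD qpiZ; apply: NL => //.
by rewrite rmorph_prod; exact: Np.
Qed.

(* The universal property of T(V); the R-algebra structure of C is given by    *)
(* a central ring morphism.                                                    *)
Section Lift.
Context (C : pzRingType) (alpha : {rmorphism R -> C}).
Context (alphaC : forall a c, alpha a * c = c * alpha a).
Context (f : V -> C) (fL : forall a x y, f (a *: x + y) = alpha a * f x + f y).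

Definition free_lift (g : free_alg) : C :=
  \sum_(m <- msupp g) alpha g@_m * \prod_(x <- fmonom_val m) f x.

Lemma free_liftEw (d : {fset {fmonom V}}) (g : free_alg) : (msupp g `<=` d)%fset ->
  free_lift g = \sum_(m <- d) alpha g@_m * \prod_(x <- fmonom_val m) f x.
Proof.
move=> gd; rewrite /free_lift (big_fset_incl _ gd) //= => m _ /mcoeff_outdom ->.
by rewrite rmorph0 mul0r.
Qed.

Lemma free_liftB : zmod_morphism free_lift.
Proof.
move=> g h; pose d := (msupp g `|` msupp h)%fset.
rewrite !(@free_liftEw d) ?fsubsetUl ?fsubsetUr ?msuppB_le // -sumrB.
by apply: eq_bigr => m _; rewrite mcoeffB rmorphB mulrBl.
Qed.
HB.instance Definition _ := GRing.isZmodMorphism.Build free_alg C free_lift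
  free_liftB.

Lemma free_liftU a m :
  free_lift << a *g m >> = alpha a * \prod_(x <- fmonom_val m) f x.
Proof. by rewrite (free_liftEw msuppU_le) big_seq_fset1 mcoeffUU. Qed.

Lemma free_liftM : {morph free_lift : g h / g * h}.
Proof.
move=> g h; rewrite [in LHS]malgM_def /fgmul raddf_sum mulr_suml.
apply: eq_bigr => k _; rewrite raddf_sum mulr_sumr; apply: eq_bigr => l _.
rewrite [LHS]free_liftU fmM big_cat rmorphM -!mulrA; congr (_ * _).
by rewrite !mulrA alphaC.
Qed.

Lemma free_lift1 : free_lift 1 = 1.
Proof. by rewrite [free_lift 1]free_liftU rmorph1 fm1 big_nil mulr1. Qed.

Lemma free_lift_gen x : free_lift (free_gen x) = f x.
Proof. by rewrite /free_gen free_liftU fmU big_seq1 rmorph1 mul1r. Qed.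

Lemma free_liftZ a g : free_lift (a *: g) = alpha a * free_lift g.
Proof.
rewrite (free_liftEw (msuppZ_le _ _)) /free_lift mulr_sumr.
by apply: eq_bigr => m _; rewrite mcoeffZ rmorphM mulrA.
Qed.

Definition free_liftR : {rmorphism free_alg -> C} :=
  HB.pack free_lift
    (GRing.isMonoidMorphism.Build free_alg C free_lift (free_lift1, free_liftM)).

Lemma free_lift_rel t : linearity_relations t -> free_liftR t = 0.
Proof.
move=> [a [x [y ->]]]; rewrite rmorphB rmorphD /= free_liftZ !free_lift_gen.
by rewrite fL subrr.
Qed.

Definition tensor_lift : tensor_alg -> C := quot_lift free_liftR.

Lemma tensor_lift_qpi g : tensor_lift (qpi _ g) = free_liftR g.
Proof. exact: quot_liftE free_lift_rel g. Qed.
Lemma tensor_lift_gen x : tensor_lift (tensor_gen x) = f x.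
Proof. by rewrite tensor_lift_qpi /= free_lift_gen. Qed.
Lemma tensor_liftZ a t : tensor_lift (a *: t) = alpha a * tensor_lift t.
Proof.
by rewrite -(qreprK t) -qpiZ !tensor_lift_qpi /= free_liftZ.
Qed.
Lemma tensor_liftB : zmod_morphism tensor_lift.
Proof.
move=> s t; rewrite -(qreprK s) -(qreprK t) -qpiB !tensor_lift_qpi.
exact: rmorphB.
Qed.
Lemma tensor_lift1 : tensor_lift 1 = 1.
Proof. by rewrite [LHS](tensor_lift_qpi 1) rmorph1. Qed.
Lemma tensor_liftM : {morph tensor_lift : s t / s * t}.
Proof.
move=> s t; rewrite -(qreprK s) -(qreprK t) -qpiM !tensor_lift_qpi.
exact: rmorphM.
Qed.
Definition tensor_liftR : {rmorphism tensor_alg -> C} :=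
  HB.pack tensor_lift
    (GRing.isZmodMorphism.Build tensor_alg C tensor_lift tensor_liftB)
    (GRing.isMonoidMorphism.Build tensor_alg C tensor_lift
      (tensor_lift1, tensor_liftM)).


End Lift.

End TensorAlgebra.

(* End_R(M), with composition as product. *)
Section Endomorphisms.
Context (R : comNzRingType) (M : lmodType R).

Definition endo : Type := {linear M -> M}.
HB.instance Definition _ := gen_eqMixin endo.
HB.instance Definition _ := gen_choiceMixin endo.

Definition endo_fun (f : endo) : M -> M := f.
Coercion endo_fun : endo >-> Funclass.

Definition mk_endo (f : M -> M) (fL : linear f) : endo :=
  HB.pack f (GRing.isLinear.Build R M M *:%R f fL).

Lemma endoP (f g : endo) : (forall u, f u = g u) -> f = g.
Proof.
case: f => f [[fB] [fZ]]; case: g => g [[gB] [gZ]] /= fg.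
have {}fg : f = g by apply/funext.
rewrite fg in fB fZ *.
by rewrite (Prop_irrelevance fB gB) (Prop_irrelevance fZ gZ).
Qed.

Lemma endo_linear (f : endo) : linear f.
Proof. exact: linearP. Qed.

Lemma endo0_subproof : linear (fun _ : M => 0 : M).
Proof. by move=> a u v; rewrite scaler0 addr0. Qed.
Lemma endoN_subproof (f : endo) : linear (fun u => - f u).
Proof. by move=> a u v; rewrite endo_linear opprD scalerN. Qed.
Lemma endoD_subproof (f g : endo) : linear (fun u => f u + g u).
Proof. by move=> a u v; rewrite !endo_linear scalerDr addrACA. Qed.
Lemma endo1_subproof : linear (fun u : M => u).
Proof. by []. Qed.
Lemma endoM_subproof (f g : endo) : linear (fun u => f (g u)).
Proof. by move=> a u v; rewrite !endo_linear. Qed.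
Lemma endoZ_subproof (a : R) (f : endo) : linear (fun u => a *: f u).
Proof. by move=> b u v; rewrite endo_linear scalerDr !scalerA mulrC. Qed.

Definition endo_zero : endo := mk_endo endo0_subproof.
Definition endo_opp f : endo := mk_endo (endoN_subproof f).
Definition endo_add f g : endo := mk_endo (endoD_subproof f g).
Definition endo_one : endo := mk_endo endo1_subproof.
Definition endo_mul f g : endo := mk_endo (endoM_subproof f g).
Definition endo_scale a f : endo := mk_endo (endoZ_subproof a f).

Lemma endo_addA : associative endo_add.
Proof. by move=> f g h; apply: endoP => u; exact: addrA. Qed.
Lemma endo_addC : commutative endo_add.
Proof. by move=> f g; apply: endoP => u; exact: addrC. Qed.
Lemma endo_add0 : left_id endo_zero endo_add.
Proof. by move=> f; apply: endoP => u; exact: add0r. Qed.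
Lemma endo_addN : left_inverse endo_zero endo_opp endo_add.
Proof. by move=> f; apply: endoP => u; exact: addNr. Qed.
HB.instance Definition _ :=
  GRing.isZmodule.Build endo endo_addA endo_addC endo_add0 endo_addN.

Lemma endo_mulA : associative endo_mul.
Proof. by move=> f g h; apply: endoP. Qed.
Lemma endo_mul1 : left_id endo_one endo_mul.
Proof. by move=> f; apply: endoP. Qed.
Lemma endo_mulr1 : right_id endo_one endo_mul.
Proof. by move=> f; apply: endoP. Qed.
Lemma endo_mulDl : left_distributive endo_mul +%R.
Proof. by move=> f g h; apply: endoP. Qed.
Lemma endo_mulDr : right_distributive endo_mul +%R.
Proof. by move=> f g h; apply: endoP => u; exact: (raddfD (f : {linear M -> M})). Qed.
HB.instance Definition _ := GRing.Zmodule_isPzRing.Build endo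
  endo_mulA endo_mul1 endo_mulr1 endo_mulDl endo_mulDr.

Lemma endo_scaleA a b f : endo_scale a (endo_scale b f) = endo_scale (a * b) f.
Proof. by apply: endoP => u; exact: scalerA. Qed.
Lemma endo_scale1 : left_id 1 endo_scale.
Proof. by move=> f; apply: endoP => u; exact: scale1r. Qed.
Lemma endo_scaleDr : right_distributive endo_scale +%R.
Proof. by move=> a f g; apply: endoP => u; exact: scalerDr. Qed.
Lemma endo_scaleDl f : {morph endo_scale^~ f : a b / a + b}.
Proof. by move=> a b; apply: endoP => u; exact: scalerDl. Qed.
HB.instance Definition _ := GRing.Zmodule_isLmodule.Build R endo
  endo_scaleA endo_scale1 endo_scaleDr endo_scaleDl.

Lemma endoDE (f g : endo) u : (f + g) u = f u + g u. Proof. by []. Qed.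
Lemma endoME (f g : endo) u : (f * g) u = f (g u). Proof. by []. Qed.
Lemma endo1E u : (1 : endo) u = u. Proof. by []. Qed.
Lemma endoZE (a : R) (f : endo) u : (a *: f) u = a *: f u. Proof. by []. Qed.

Definition subalgebra (N : set endo) : Prop :=
  [/\ submodule N, N 1 & forall f g, N f -> N g -> N (f * g)].

Definition generated_subalgebra (S : set endo) : set endo :=
  smallest subalgebra S.

Lemma generated_subalgebraP (S : set endo) :
  subalgebra (generated_subalgebra S).
Proof.
split=> [|N [[]]|f g Sf Sg N NS] //.
  split=> [N [[[]]]|a f g Sf Sg N NS] //.
  by have [[[_ NL] _ _] _] := NS; apply: NL; [exact: Sf|exact: Sg].
by have [[_ _ NM] _] := NS; apply: NM; [exact: Sf|exact: Sg].
Qed.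

End Endomorphisms.

Section ExteriorAlgebra.
Context (R : comNzRingType) (V : lmodType R).

Definition exterior_relations : set (tensor_alg V) :=
  [set t | exists x, t = tensor_gen x * tensor_gen x].

(* The Grassmann algebra of V; its product is the wedge. *)
Definition exterior_alg : Type := quot_alg exterior_relations.
HB.instance Definition _ := GRing.PzRing.on exterior_alg.
HB.instance Definition _ := GRing.Lmodule.on exterior_alg.

Definition ext_gen (x : V) : exterior_alg := qpi _ (tensor_gen x).

Lemma ext_gen_linear : linear ext_gen.
Proof. by move=> a x y; rewrite /ext_gen tensor_gen_linear qpiD qpiZ. Qed.

Lemma ext_gen_sqr x : ext_gen x * ext_gen x = 0.
Proof.
have r : exterior_relations (tensor_gen x * tensor_gen x) by exists x.
by rewrite -[RHS](qpi_rel r) qpiM.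
Qed.

Lemma ext_scalerAl (a : R) (u v : exterior_alg) : a *: (u * v) = (a *: u) * v.
Proof. exact: quot_scalerAl. Qed.
Lemma ext_scalerAr (a : R) (u v : exterior_alg) : a *: (u * v) = u * (a *: v).
Proof. exact: quot_scalerAr. Qed.

Lemma exterior_ind (N : set exterior_alg) : submodule N ->
  (forall s : seq V, N (\prod_(x <- s) ext_gen x)) -> forall u, N u.
Proof.
move=> [N0 NL] Np u; rewrite -(qreprK u).
apply: (@tensor_ind _ _ [set t | N (qpi _ t)]) => [|s] /=.
  by split=> [|a s t Ns Nt] /=; [rewrite raddf0|rewrite qpiD qpiZ; exact: NL].
by rewrite rmorph_prod; exact: Np.
Qed.

Section Lift.
Context (C : pzRingType) (alpha : {rmorphism R -> C}).
Context (alphaC : forall a c, alpha a * c = c * alpha a).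
Context (f : V -> C) (fL : forall a x y, f (a *: x + y) = alpha a * f x + f y).
Context (f0 : forall x, f x * f x = 0).

Let F : {rmorphism tensor_alg V -> C} := tensor_liftR alphaC fL.

Definition exterior_lift : exterior_alg -> C := quot_lift F.

Lemma exterior_lift_rel t : exterior_relations t -> F t = 0.
Proof. by move=> [x ->]; rewrite rmorphM /F /= tensor_lift_gen. Qed.

Lemma exterior_liftE t : exterior_lift (qpi _ t) = F t.
Proof. exact: quot_liftE exterior_lift_rel t. Qed.
Lemma exterior_lift_gen x : exterior_lift (ext_gen x) = f x.
Proof. by rewrite exterior_liftE /F /= tensor_lift_gen. Qed.
Lemma exterior_liftZ a u : exterior_lift (a *: u) = alpha a * exterior_lift u.
Proof. by rewrite -(qreprK u) -qpiZ !exterior_liftE /F /= tensor_liftZ. Qed.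
Lemma exterior_liftD u v :
  exterior_lift (u + v) = exterior_lift u + exterior_lift v.
Proof.
by rewrite -(qreprK u) -(qreprK v) -qpiD !exterior_liftE rmorphD.
Qed.
Lemma exterior_lift1 : exterior_lift 1 = 1.
Proof. by rewrite [LHS](exterior_liftE 1) rmorph1. Qed.
Lemma exterior_liftM u v :
  exterior_lift (u * v) = exterior_lift u * exterior_lift v.
Proof.
by rewrite -(qreprK u) -(qreprK v) -qpiM !exterior_liftE rmorphM.
Qed.
End Lift.

Definition ext_scalar (a : R) : exterior_alg := a *: (1 : exterior_alg).

Lemma ext_scalarB : zmod_morphism ext_scalar.
Proof. by move=> a b; rewrite /ext_scalar scalerBl. Qed.
Lemma ext_scalarM : monoid_morphism ext_scalar.
Proof.
split; first by rewrite /ext_scalar scale1r.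
by move=> a b; rewrite /ext_scalar -ext_scalerAl mul1r scalerA.
Qed.
HB.instance Definition _ :=
  GRing.isZmodMorphism.Build R exterior_alg ext_scalar ext_scalarB.
HB.instance Definition _ :=
  GRing.isMonoidMorphism.Build R exterior_alg ext_scalar ext_scalarM.

Lemma ext_scalarC a (u : exterior_alg) : ext_scalar a * u = u * ext_scalar a.
Proof. by rewrite /ext_scalar -ext_scalerAl -ext_scalerAr mul1r mulr1. Qed.

Lemma ext_scalarE a (u : exterior_alg) : ext_scalar a * u = a *: u.
Proof. by rewrite /ext_scalar -ext_scalerAl mul1r. Qed.

Lemma ext_opp_gen_linear a x y :
  - ext_gen (a *: x + y) = ext_scalar a * (- ext_gen x) + - ext_gen y.
Proof. by rewrite ext_gen_linear opprD ext_scalarE scalerN. Qed.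

Lemma ext_opp_gen_sqr x : (- ext_gen x) * (- ext_gen x) = 0.
Proof. by rewrite mulrNN ext_gen_sqr. Qed.

Definition grade_involution : exterior_alg -> exterior_alg :=
  exterior_lift ext_scalarC ext_opp_gen_linear.

Lemma grade_involution_gen x : grade_involution (ext_gen x) = - ext_gen x.
Proof. exact: exterior_lift_gen ext_opp_gen_sqr x. Qed.
Lemma grade_involution1 : grade_involution 1 = 1.
Proof. exact: exterior_lift1 ext_opp_gen_sqr. Qed.
Lemma grade_involutionM u v :
  grade_involution (u * v) = grade_involution u * grade_involution v.
Proof. exact: exterior_liftM ext_opp_gen_sqr u v. Qed.
Lemma grade_involution_linear : linear grade_involution.
Proof.
move=> a u v; rewrite /grade_involution exterior_liftD; last first.
  exact: ext_opp_gen_sqr.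
by rewrite exterior_liftZ ?ext_scalarE //; exact: ext_opp_gen_sqr.
Qed.

End ExteriorAlgebra.

Section LeftContraction.
Context (R : comNzRingType) (V : lmodType R) (B : {biscalar V}).

Local Notation L := (exterior_alg V).
Local Notation hat := (@grade_involution R V).

Definition is_left_contraction (x : V) (d : L -> L) : Prop :=
  [/\ linear d, d 1 = 0, forall y, d (ext_gen y) = B x y *: (1 : L)
    & forall u v, d (u * v) = d u * v + hat u * d v].

Lemma left_contraction_unique x d d' :
  is_left_contraction x d -> is_left_contraction x d' -> d = d'.
Proof.
move=> [dL d1 dg dM] [d'L d'1 d'g d'M]; apply/funext.
apply: (@exterior_ind R V [set u | d u = d' u]) => [|s] /=.
  split=> [|a u v /= e e']; last by rewrite dL d'L e e'.
  by rewrite /= (linear_prop0 dL) (linear_prop0 d'L).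
by elim: s => [|x' s IH]; rewrite ?big_nil ?d1 // big_cons dM d'M dg d'g IH.
Qed.

(* Existence: y in V acts on L x L by (p, q) |-> (- y p + B(x,y) q, y q); this *)
(* extends to an action of L, and the contraction of u is the first component  *)
(* of u . (0, 1).                                                              *)
Section Existence.
Context (x : V).

Definition contraction_action (y : V) (w : L * L) : L * L :=
  (- (ext_gen y * w.1) + B x y *: w.2, ext_gen y * w.2).

Lemma contraction_action_linear y : linear (contraction_action y).
Proof.
move=> a [p q] [p' q']; congr (_, _) => /=; last first.
  by rewrite mulrDr ext_scalerAr.
rewrite mulrDr -ext_scalerAr opprD !scalerDr scalerN !scalerA (mulrC (B x y)).
by rewrite addrACA.
Qed.

Definition contraction_endo y : endo (L * L)%type :=
  mk_endo (contraction_action_linear y).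

Definition endo_scalar (M : lmodType R) (a : R) : endo M := a *: (1 : endo M).
Lemma endo_scalarB M : zmod_morphism (@endo_scalar M).
Proof. by move=> a b; rewrite /endo_scalar scalerBl. Qed.
Lemma endo_scalarM M : monoid_morphism (@endo_scalar M).
Proof.
split; first by rewrite /endo_scalar scale1r.
by move=> a b; apply: endoP => u; exact/esym/scalerA.
Qed.
HB.instance Definition _ M :=
  GRing.isZmodMorphism.Build R (endo M) (@endo_scalar M) (@endo_scalarB M).
HB.instance Definition _ M :=
  GRing.isMonoidMorphism.Build R (endo M) (@endo_scalar M) (@endo_scalarM M).
Lemma endo_scalarC (M : lmodType R) a (f : endo M) :
  endo_scalar M a * f = f * endo_scalar M a.
Proof.
by apply: endoP => u; exact/esym/(linear_propZ (endo_linear f)).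
Qed.

Lemma contraction_endo_lin a y z : contraction_endo (a *: y + z) =
  endo_scalar (L * L)%type a * contraction_endo y + contraction_endo z.
Proof.
apply: endoP => -[p q]; congr (_, _) => /=.
  rewrite /= ext_gen_linear linearPr mulrDl -ext_scalerAl opprD scalerDl.
  by rewrite scalerDr scalerN scalerA addrACA.
by rewrite ext_gen_linear mulrDl -ext_scalerAl.
Qed.

Lemma contraction_endo_sqr y : contraction_endo y * contraction_endo y = 0.
Proof.
apply: endoP => -[p q]; congr (_, _) => /=.
  rewrite mulrDr mulrN mulrA ext_gen_sqr mul0r oppr0 add0r.
  by rewrite -ext_scalerAr addNr.
by rewrite mulrA ext_gen_sqr mul0r.
Qed.

Lemma contraction_sum_aux (a : R) (h h' c c' p q : L) :
  a *: (h * p + c * q) + (h' * p + c' * q) =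
  (a *: h + h') * p + (a *: c + c') * q.
Proof. by rewrite scalerDr addrACA !ext_scalerAl -!mulrDl. Qed.

Lemma contraction_cons_aux (y h c p q u : L) (b : R) :
  - (y * (h * p + c * q)) + b *: (u * q) =
  (- y * h) * p + (- (y * c) + b *: u) * q.
Proof.
by rewrite mulrDr opprD mulrDl !mulNr !mulrA ext_scalerAl -addrA.
Qed.

Let F : L -> endo (L * L)%type :=
  exterior_lift (@endo_scalarC (L * L)%type) contraction_endo_lin.
Let d u := (F u (0, 1)).1.

Lemma contraction_linear u v a w : F (a *: u + v) w = a *: F u w + F v w.
Proof.
have f0 := contraction_endo_sqr.
by rewrite /F (exterior_liftD _ _ f0) (exterior_liftZ _ _ f0).
Qed.

Lemma contraction_actE u w :
  F u w = (hat u * w.1 + d u * w.2, u * w.2).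
Proof.
have f0 := contraction_endo_sqr.
apply: (@exterior_ind R V
  [set u | forall w, F u w = (hat u * w.1 + d u * w.2, u * w.2)]) => [|s] /=.
  split=> /= [{}w|a {}u v Fu Fv {}w].
    have F0 w' : F 0 w' = 0.
      have := contraction_linear 0 0 (-1) w'; rewrite scaler0 addr0 => ->.
      by rewrite scaleN1r addNr.
    rewrite /d !F0 (linear_prop0 (@grade_involution_linear R V)) !mul0r.
    by rewrite addr0.
  rewrite contraction_linear Fu Fv /d contraction_linear /=.
  rewrite grade_involution_linear -contraction_sum_aux mulrDl -ext_scalerAl.
  by [].
elim: s => [|y s IH] {}w.
  rewrite big_nil /d /F !(exterior_lift1 _ _ f0) grade_involution1 !mul1r.
  by rewrite /= mul0r addr0; case: w.
rewrite big_cons; set u' := \prod_(x <- s) _ in IH *.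
have FM w' : F (ext_gen y * u') w' = contraction_action y (F u' w').
  by rewrite /F (exterior_liftM _ _ f0) (exterior_lift_gen _ _ f0).
rewrite FM IH /contraction_action /d FM /= grade_involutionM.
rewrite grade_involution_gen IH /= mulr0 add0r !mulr1 -contraction_cons_aux.
by rewrite mulrA.
Qed.

Lemma left_contraction_exists_subproof : is_left_contraction x d.
Proof.
have f0 := contraction_endo_sqr.
split=> [a u v||y|u v].
- by rewrite /d contraction_linear.
- by rewrite /d /F (exterior_lift1 _ _ f0).
- by rewrite /d /F (exterior_lift_gen _ _ f0) /= mulr0 oppr0 add0r.
rewrite {1}/d /F (exterior_liftM _ _ f0) -/F.
rewrite -[X in X.1]/(F u (F v (0, 1))) [F v _]contraction_actE.
by rewrite contraction_actE /= mulr0 add0r !mulr1 addrC.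
Qed.

End Existence.

Lemma left_contraction_exists x : exists d, is_left_contraction x d.
Proof. by eexists; exact: left_contraction_exists_subproof. Qed.

Definition left_contraction (x : V) : L -> L :=
  projT1 (cid (left_contraction_exists x)).

Lemma left_contractionP x : is_left_contraction x (left_contraction x).
Proof. exact: projT2 (cid (left_contraction_exists x)). Qed.

Lemma clifford_op_linear x :
  linear (fun u => left_contraction x u + ext_gen x * u).
Proof.
have [dL _ _ _] := left_contractionP x; move=> a u v.
by rewrite dL mulrDr -ext_scalerAr scalerDr addrACA.
Qed.

Definition clifford_op (x : V) : endo L := mk_endo (clifford_op_linear x).

End LeftContraction.

(* A hypothesis weaker than the bijectivity of V -> V^*: over a commutative    *)
(* ring only injectivity is required (on both sides, as B is not symmetric).   *)
Definition nondegenerate_bilinear (R : comNzRingType) (V : lmodType R)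
    (B : V -> V -> R) : Prop :=
  (forall x, (forall y, B x y = 0) -> x = 0) /\
  (forall y, (forall x, B x y = 0) -> y = 0).

Section CliffordBilinear.
Context (R : comNzRingType) (V : lmodType R) (B : {biscalar V}).

Local Notation E := (endo (exterior_alg V)).

Definition in_clifford : {pred E} :=
  fun f => `[< generated_subalgebra (range (clifford_op B)) f >].

Lemma in_cliffordP f :
  reflect (generated_subalgebra (range (clifford_op B)) f) (f \in in_clifford).
Proof. exact: asboolP. Qed.

Lemma in_clifford_subring : subring_closed in_clifford.
Proof.
have [[_ NL] N1 NM] := generated_subalgebraP (range (clifford_op B)).
split=> [|f g /in_cliffordP Nf /in_cliffordP Ng|f g /in_cliffordP Nf
         /in_cliffordP Ng]; apply/in_cliffordP => //; last exact: NM.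
by rewrite addrC -scaleN1r; exact: NL.
Qed.

Lemma in_clifford_submod : GRing.subsemimod_closed in_clifford.
Proof.
have [[N0 NL] _ _] := generated_subalgebraP (range (clifford_op B)).
split=> [|a f /in_cliffordP Nf]; last first.
  by apply/in_cliffordP; rewrite -[a *: f]addr0; exact: NL.
split=> [|f g /in_cliffordP Nf /in_cliffordP Ng]; apply/in_cliffordP => //.
by rewrite -[f]scale1r; exact: NL.
Qed.

Definition clifford_bilinear : Type := {f : E | f \in in_clifford}.

HB.instance Definition _ := SubChoice.on clifford_bilinear.
HB.instance Definition _ := GRing.SubChoice_isSubPzRing.Build E in_clifford
  clifford_bilinear in_clifford_subring.
HB.instance Definition _ := GRing.SubZmodule_isSubLmodule.Build R E in_clifford
  clifford_bilinear in_clifford_submod.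

Lemma clifford_op_in x : clifford_op B x \in in_clifford.
Proof. by apply/in_cliffordP; apply: sub_gen_smallest; exists x. Qed.

Definition clifford_bilinear_gen (x : V) : clifford_bilinear :=
  exist _ (clifford_op B x) (clifford_op_in x).

Definition clifford_bilinear_part (b : bool) : set clifford_bilinear :=
  span (parity_products clifford_bilinear_gen b).

End CliffordBilinear.

Section CliffordQuadratic.
Context (R : comNzRingType) (V : lmodType R) (Q : V -> R).

Definition clifford_relations : set (tensor_alg V) :=
  [set t | exists x, t = tensor_gen x * tensor_gen x - (Q x)%:A].

Definition clifford_quadratic : Type := quot_alg clifford_relations.
HB.instance Definition _ := GRing.PzRing.on clifford_quadratic.
HB.instance Definition _ := GRing.Lmodule.on clifford_quadratic.

(* The sum of the V^{\otimes k} with k of parity b. *)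
Definition tensor_part (b : bool) : set (tensor_alg V) :=
  span (parity_products (@tensor_gen R V) b).

Definition clifford_quadratic_part (b : bool) : set clifford_quadratic :=
  qpi clifford_relations @` tensor_part b.

End CliffordQuadratic.

Arguments clifford_bilinear_part {R V} B b.
Arguments clifford_quadratic_part {R V} Q b.

(* Main.v *)
Require Import Defs.
From mathcomp Require Import all_boot all_algebra.
From mathcomp Require Import boolp classical_sets.

Import GRing.Theory.
Local Open Scope classical_set_scope.
Local Open Scope ring_scope.

Set Implicit Arguments.
Unset Strict Implicit.
Unset Printing Implicit Defensive.

(** The operators L_x satisfy L_x ^ 2 = Q x, so x |-> L_x extends to an algebra
    morphism [chevalley_rep] from Cl(Q) to End(/\V), whose image is Cl(B). The
    isomorphism is its inverse, and the only real issue is injectivity. That is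
    settled by a linear map [quantization] from /\V to Cl(Q) such that

      quantization (chevalley_rep c u) = c * quantization u,  quantization 1 = 1:

    an operator f in Cl(B) is then the image of quantization (f 1), so that
    [clifford_iso] f = quantization (f 1) is the inverse morphism.

    The quantization map is Chevalley's construction run backwards. Contraction
    by x also exists on Cl(Q), as the antiderivation d_x with d_x y = B x y: it
    is compatible with the relation y * y = Q y because
    d_x (y * y) = B x y *: y - B x y *: y = 0. The operators
    M_x c = x * c - d_x c square to Q x - B x x = 0, so they make Cl(Q) a module
    over the Grassmann algebra, and quantization u is the action of u on 1. By
    definition quantization (x /\ u) = x * quantization u - d_x (quantization u).
    An induction on u, which rests on the anticommutation of contractions, shows
    that quantization commutes with contractions ([transport_contraction]);
    adding the contraction term of L_x therefore cancels the correction - d_x,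
    and quantization (L_x u) = x * quantization u.

    Both /\V and Cl(Q) are treated as instances of one structure: a module
    generated from a vector e (the unit) by operators g x (left multiplications),
    with contractions d x that kill e and satisfy d x g y + g y d x = B x y. *)

(** * Spans and products of generators *)

Section Spans.
Context (R : pzRingType).

Lemma span_submodule (M : lmodType R) (S : set M) : submodule (Defs.span S).
Proof.
split=> [N [[]]|a u v Su Sv N NS] //.
by have [[_ NL] _] := NS; apply: NL; [exact: Su|exact: Sv].
Qed.

Lemma image_span (U W : lmodType R) (f : U -> W) (S : set U) :
  linear f -> f @` Defs.span S = Defs.span (f @` S).
Proof.
move=> fL; have [T0 TL] := span_submodule (f @` S).
have [S0 SL] := span_submodule S.
apply/seteqP; split=> [_ [u Su <-]|].
  apply: (Su [set u | Defs.span (f @` S) (f u)]); split=> [|x Sx]; last first.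
    by apply: sub_gen_smallest; exists x.
  split=> [|a x y /= Sx Sy] /=; first by rewrite (linear_prop0 fL).
  by rewrite fL; exact: TL.
apply: smallest_sub => [|_ [x Sx <-]]; last first.
  by exists x => //; exact: sub_gen_smallest.
split=> [|a _ _ [x Sx <-] [y Sy <-]].
  by exists 0 => //; exact: linear_prop0.
by exists (a *: x + y); [exact: SL|exact: fL].
Qed.

End Spans.

Lemma image_parity_products (V : Type) (A C : pzRingType) (g : V -> A)
    (f : A -> C) (b : bool) : monoid_morphism f ->
  f @` parity_products g b = parity_products (f \o g) b.
Proof.
move=> [f1 fM].
have fp s : f (\prod_(x <- s) g x) = \prod_(x <- s) f (g x).
  exact: (big_morph f fM f1).
apply/seteqP; split=> [_ [_ [s [sb ->]] <-]|_ [s [sb ->]]].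
  by exists s; split; last exact: fp.
by exists (\prod_(x <- s) g x); [exists s|exact: fp].
Qed.

(** * Contractions on a module generated by operators *)

Section EndoTheory.
Context (R : comNzRingType) (M : lmodType R) (f : endo M).

Lemma endo0 : f 0 = 0.
Proof. exact: linear_prop0 (endo_linear f). Qed.
Lemma endoZ a u : f (a *: u) = a *: f u.
Proof. exact: linear_propZ (endo_linear f) a u. Qed.
Lemma endoD u v : f (u + v) = f u + f v.
Proof. exact: (raddfD (f : {linear M -> M})). Qed.
Lemma endoN u : f (- u) = - f u.
Proof. exact: (raddfN (f : {linear M -> M})). Qed.
Lemma endoB u v : f (u - v) = f u - f v.
Proof. exact: (raddfB (f : {linear M -> M})). Qed.

End EndoTheory.

Section Contractions.
Context (R : comNzRingType) (V : lmodType R).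

(** [e] is a cyclic vector for the algebra generated by the operators [g x], phrased as
    an induction principle. *)
Definition generates (M : lmodType R) (g : V -> endo M) (e : M) : Prop :=
  forall N : set M, submodule N -> N e ->
    (forall x u, N u -> N (g x u)) -> forall u, N u.

Context (B : {biscalar V}).

(** The second clause is the recursion rule of a left contraction on products that
    begin with a generator, so it determines [d] on everything generated from [e]. *)
Definition contracts (M : lmodType R) (g : V -> endo M) (e : M)
    (d : V -> endo M) : Prop :=
  (forall x, d x e = 0) /\
  forall x y u, d x (g y u) = B x y *: u - g y (d x u).

Section Theory.
Context (M : lmodType R) (g d : V -> endo M) (e : M).
Hypotheses (gen : generates g e) (gd : contracts g e d).

Lemma contraction_linear a x y u : d (a *: x + y) u = a *: d x u + d y u.
Proof.
have [d0 dg] := gd; move: u.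
apply: (gen (N := [set u | d (a *: x + y) u = a *: d x u + d y u])).
- split=> [|b u v /= eu ev] /=.
    by rewrite !endo0 scaler0 addr0.
  rewrite !endo_linear eu ev !scalerDr !scalerA (mulrC b) !addrA.
  by congr (_ + _); rewrite -!addrA; congr (_ + _); exact: addrC.
- by rewrite /= !d0 scaler0 addr0.
move=> z u /= eu; rewrite !dg eu endo_linear linearPl.
rewrite scalerDl -scalerA scalerBr opprD -!addrA; congr (_ + _).
by rewrite addrCA.
Qed.

Lemma contraction_anticomm x y u : d x (d y u) = - d y (d x u).
Proof.
have [d0 dg] := gd; move: u.
apply: (gen (N := [set u | d x (d y u) = - d y (d x u)])).
- split=> [|b u v /= eu ev] /=.
    by rewrite !endo0 oppr0.
  by rewrite !endo_linear eu ev opprD scalerN.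
- by rewrite /= !d0 !endo0 oppr0.
move=> z u /= eu; rewrite !dg !endoB !endoZ !dg eu.
by rewrite endoN !opprB addrA.
Qed.

(** Not an instance of [contraction_anticomm], which only yields twice the square. *)
Lemma contraction_nil x u : d x (d x u) = 0.
Proof.
have [d0 dg] := gd; move: u; apply: (gen (N := [set u | d x (d x u) = 0])).
- split=> [|b u v /= eu ev] /=; first by rewrite !endo0.
  by rewrite !endo_linear eu ev scaler0 addr0.
- by rewrite /= d0 endo0.
move=> z u /= eu; rewrite !dg endoB endoZ dg eu.
by rewrite endo0 subr0 subrr.
Qed.

(** Both Clifford multiplication on /\V ([a = 1]) and wedge multiplication on Cl(Q)
    ([a = -1]) have this form. *)
Section Deformation.
Context (a : R).

Definition deformed_op (x : V) : endo M := g x + a *: d x.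

Lemma deformed_opE x u : deformed_op x u = g x u + a *: d x u.
Proof. by []. Qed.

(** The cross terms add up to [a] times the anticommutator of [g x] and [d x], which is
    the scalar [B x x]. *)
Lemma deformed_op_sqr x u :
  deformed_op x (deformed_op x u) = g x (g x u) + (a * B x x) *: u.
Proof.
have [_ dg] := gd; rewrite !deformed_opE endoD endoD dg.
rewrite !endoZ contraction_nil scaler0 addr0.
by rewrite scalerBr scalerA -addrA [X in _ + X]addrCA subrr addr0.
Qed.

Lemma deformed_op_linear :
  (forall b x y u, g (b *: x + y) u = b *: g x u + g y u) ->
  forall b x y u,
    deformed_op (b *: x + y) u = b *: deformed_op x u + deformed_op y u.
Proof.
move=> gL b x y u; rewrite !deformed_opE gL contraction_linear !scalerDr.
by rewrite !scalerA (mulrC a) addrACA.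
Qed.

End Deformation.
End Theory.

Section Transport.
Context (M M' : lmodType R) (g d : V -> endo M) (g' d' : V -> endo M').
Context (e : M) (e' : M').
Hypotheses (gen : generates g e) (gd : contracts g e d).
Hypotheses (gen' : generates g' e') (gd' : contracts g' e' d').
Context (a : R) (h : M -> M').
Hypotheses (hL : linear h) (he : h e = e').
Hypothesis hg : forall x u, h (g x u) = deformed_op g' d' a x (h u).

(** By induction on [u]: for [g y u], the extra term [a *: d' y] that [h] introduces is
    moved past [d' x] by anticommutation. *)
Lemma transport_contraction x u : h (d x u) = d' x (h u).
Proof.
have [d0 dg] := gd; have [d'0 d'g] := gd'; have h0 := linear_prop0 hL.
move: u; apply: (gen (N := [set u | h (d x u) = d' x (h u)])).
- split=> [|b u v /= eu ev] /=.
    by rewrite endo0 h0 endo0.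
  by rewrite endo_linear !hL endo_linear eu ev.
- by rewrite /= d0 he d'0 h0.
move=> y u /= eu; rewrite dg addrC -scaleN1r hL hg (linear_propZ hL).
rewrite hg !deformed_opE eu endoD d'g endoZ.
rewrite (contraction_anticomm gen' gd' x y) scaleN1r scalerN opprD.
by rewrite [LHS]addrC addrA.
Qed.

(** Hence [h] turns the deformation by [- a] back into [g'], since the contraction terms
    cancel. *)
Lemma transport_deformed x u : h (deformed_op g d (- a) x u) = g' x (h u).
Proof.
rewrite deformed_opE addrC hL transport_contraction hg deformed_opE.
by rewrite scaleNr addrC addrK.
Qed.

End Transport.
End Contractions.

(** * The Clifford algebra of a quadratic form and its representations *)

Section CliffordQuadratic.
Context (R : comNzRingType) (V : lmodType R) (Q : V -> R).

Local Notation C := (clifford_quadratic Q).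

Definition clifford_gen (x : V) : C := qpi _ (tensor_gen x).

Lemma clifford_scalerAl (a : R) (u v : C) : a *: (u * v) = (a *: u) * v.
Proof. exact: quot_scalerAl. Qed.
Lemma clifford_scalerAr (a : R) (u v : C) : a *: (u * v) = u * (a *: v).
Proof. exact: quot_scalerAr. Qed.

Lemma clifford_gen_linear : linear clifford_gen.
Proof. by move=> a x y; rewrite /clifford_gen tensor_gen_linear qpiD qpiZ. Qed.

Lemma clifford_gen_sqr x : clifford_gen x * clifford_gen x = Q x *: (1 : C).
Proof.
have r : clifford_relations Q (tensor_gen x * tensor_gen x - (Q x)%:A).
  by exists x.
by apply/eqP; rewrite -subr_eq0 -qpiM -qpi1 -qpiZ -qpiB (qpi_rel r).
Qed.

Lemma clifford_ind (N : set C) : submodule N ->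
  (forall s : seq V, N (\prod_(x <- s) clifford_gen x)) -> forall c, N c.
Proof.
move=> [N0 NL] Np u; rewrite -(qreprK u).
apply: (@tensor_ind _ _ [set t | N (qpi _ t)]) => [|s] /=.
  by split=> [|a s t Ns Nt] /=; [rewrite raddf0|rewrite qpiD qpiZ; exact: NL].
by rewrite rmorph_prod; exact: Np.
Qed.

Lemma clifford_mul_linear x : linear (fun c : C => clifford_gen x * c).
Proof. by move=> a u v; rewrite mulrDr clifford_scalerAr. Qed.

Definition clifford_mul x : endo C := mk_endo (clifford_mul_linear x).

Lemma clifford_generates : generates clifford_mul (1 : C).
Proof.
move=> N NS N1 Ng; apply: clifford_ind => // s.
by elim: s => [|x s IH]; rewrite ?big_nil // big_cons; exact: Ng.
Qed.

Lemma clifford_quadratic_partE b :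
  clifford_quadratic_part Q b = Defs.span (parity_products clifford_gen b).
Proof.
rewrite /clifford_quadratic_part /tensor_part image_span; last first.
  by move=> a s t; rewrite qpiD qpiZ.
rewrite image_parity_products //; split; [exact: qpi1|exact: qpiM].
Qed.

(** The universal property of Cl(Q), for the target End(M). *)
Section Representation.
Context (M : lmodType R) (f : V -> endo M).
Hypothesis fL : forall a x y u, f (a *: x + y) u = a *: f x u + f y u.
Hypothesis f2 : forall x u, f x (f x u) = Q x *: u.

Lemma clifford_rep_linear a x y : f (a *: x + y) = endo_scalar M a * f x + f y.
Proof. by apply: endoP => u; exact: fL. Qed.

Let F : {rmorphism tensor_alg V -> endo M} :=
  tensor_liftR (@endo_scalarC R M) clifford_rep_linear.

Definition clifford_rep : C -> endo M := quot_lift F.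

Lemma clifford_rep_rel t : clifford_relations Q t -> F t = 0.
Proof.
move=> [x ->]; rewrite rmorphB rmorphM /F /= tensor_lift_gen; last first.
  exact: clifford_rep_linear.
rewrite tensor_liftZ; last exact: clifford_rep_linear.
rewrite tensor_lift1; last exact: clifford_rep_linear.
rewrite mulr1; apply/eqP; rewrite subr_eq0; apply/eqP.
by apply: endoP => u; exact: f2.
Qed.

Lemma clifford_repE t : clifford_rep (qpi _ t) = F t.
Proof. exact: quot_liftE clifford_rep_rel t. Qed.
Lemma clifford_rep_gen x : clifford_rep (clifford_gen x) = f x.
Proof.
by rewrite clifford_repE /F /= tensor_lift_gen //; exact: clifford_rep_linear.
Qed.
Lemma clifford_repZ a c : clifford_rep (a *: c) = a *: clifford_rep c.
Proof.
rewrite -(qreprK c) -qpiZ !clifford_repE /F /= tensor_liftZ; last first.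
  exact: clifford_rep_linear.
by apply: endoP.
Qed.
Lemma clifford_repD c c' : clifford_rep (c + c') = clifford_rep c + clifford_rep c'.
Proof.
by rewrite -(qreprK c) -(qreprK c') -qpiD !clifford_repE rmorphD.
Qed.
Lemma clifford_rep1 : clifford_rep 1 = 1.
Proof. by rewrite [LHS](clifford_repE 1) rmorph1. Qed.
Lemma clifford_repM c c' : clifford_rep (c * c') = clifford_rep c * clifford_rep c'.
Proof.
by rewrite -(qreprK c) -(qreprK c') -qpiM !clifford_repE rmorphM.
Qed.

Lemma clifford_rep_linear_app a c c' u :
  clifford_rep (a *: c + c') u = a *: clifford_rep c u + clifford_rep c' u.
Proof. by rewrite clifford_repD clifford_repZ. Qed.
Lemma clifford_rep_gen_app x c u :
  clifford_rep (clifford_gen x * c) u = f x (clifford_rep c u).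
Proof. by rewrite clifford_repM clifford_rep_gen. Qed.
Lemma clifford_rep0_app u : clifford_rep 0 u = 0.
Proof. by rewrite -(scale0r 0) clifford_repZ scale0r. Qed.

End Representation.
End CliffordQuadratic.

(** * Contractions on the Clifford algebra *)

Section CliffordContraction.
Context (R : comNzRingType) (V : lmodType R) (B : {biscalar V}).

Local Notation C := (clifford_quadratic (fun x : V => B x x)).
Local Notation gen := (@clifford_gen R V (fun x : V => B x x)).

Section Action.
Context (x : V).

(** The recursion d_x (y * c) = B x y *: c - y * d_x c that should define the contraction
    on Cl(Q) is made into an operator on pairs: [pair_action y] maps (d_x c, c) to
    (d_x (y * c), y * c). Since these operators satisfy the Clifford relations, Cl(Q) acts
    on pairs, and d_x c is read off from the action of [c] on (d_x 1, 1) = (0, 1). *)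
Definition pair_action (y : V) (w : C * C) : C * C :=
  (B x y *: w.2 - gen y * w.1, gen y * w.2).

Lemma pair_action_linear y : linear (pair_action y).
Proof.
move=> a [p q] [p' q']; congr (_, _) => /=; last first.
  by rewrite mulrDr clifford_scalerAr.
rewrite mulrDr -clifford_scalerAr opprD !scalerDr scalerN !scalerA.
by rewrite (mulrC (B x y)) addrACA.
Qed.

(* Naming the module keeps later unifications on one structure of the product. *)
Let CC : lmodType R := (C * C)%type.

Definition pair_endo y : endo CC := @mk_endo R CC _ (pair_action_linear y).

Lemma pair_endo_linear a y z w :
  pair_endo (a *: y + z) w = a *: pair_endo y w + pair_endo z w.
Proof.
case: w => p q; congr (_, _) => /=.
  rewrite clifford_gen_linear linearPr mulrDl -clifford_scalerAl opprD scalerDl.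
  by rewrite scalerDr scalerN scalerA addrACA.
by rewrite clifford_gen_linear mulrDl -clifford_scalerAl.
Qed.

Lemma pair_endo_sqr y w : pair_endo y (pair_endo y w) = B y y *: w.
Proof.
case: w => p q; congr (_, _) => /=.
  rewrite mulrBr -clifford_scalerAr opprB addrCA subrr addr0.
  by rewrite mulrA clifford_gen_sqr -clifford_scalerAl mul1r.
by rewrite mulrA clifford_gen_sqr -clifford_scalerAl mul1r.
Qed.

Let F : C -> endo CC := clifford_rep pair_endo_linear.

Lemma pair_rep_snd c : (F c (0, 1)).2 = c.
Proof.
have f2 := pair_endo_sqr.
apply: (clifford_generates (N := [set c | (F c (0, 1)).2 = c])) => /=.
- split=> [|a u v /= eu ev] /=; first by rewrite (clifford_rep0_app _ f2).
  by rewrite (clifford_rep_linear_app _ f2) /= eu ev.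
- by rewrite /F (clifford_rep1 _ f2).
by move=> y u eu; rewrite (clifford_rep_gen_app _ f2) /= eu.
Qed.

Lemma clifford_contraction_linear : linear (fun c => (F c (0, 1)).1).
Proof.
have f2 := pair_endo_sqr.
by move=> a u v; rewrite /F (clifford_rep_linear_app _ f2).
Qed.

Definition clifford_contraction : endo C := mk_endo clifford_contraction_linear.

Lemma clifford_contraction1 : clifford_contraction 1 = 0.
Proof. by rewrite /= /F (clifford_rep1 _ pair_endo_sqr). Qed.

Lemma clifford_contractionM y c : clifford_contraction (gen y * c) =
  B x y *: c - gen y * clifford_contraction c.
Proof.
have f2 := pair_endo_sqr.
by rewrite /= /F (clifford_rep_gen_app _ f2) /= pair_rep_snd.
Qed.

End Action.

Lemma clifford_contracts : contracts B
  (@clifford_mul R V (fun x : V => B x x)) 1 clifford_contraction.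
Proof. by split=> *; [exact: clifford_contraction1|exact: clifford_contractionM]. Qed.

End CliffordContraction.

(** * The Grassmann algebra as a module with contractions *)

Section ExteriorModule.
Context (R : comNzRingType) (V : lmodType R).

Local Notation L := (exterior_alg V).

Lemma ext_mul_linear (x : V) : linear (fun u : L => ext_gen x * u).
Proof. by move=> a u v; rewrite mulrDr ext_scalerAr. Qed.

Definition ext_mul (x : V) : endo L := mk_endo (ext_mul_linear x).

Lemma ext_generates : generates ext_mul (1 : L).
Proof.
move=> N NS N1 Ng; apply: exterior_ind => // s.
by elim: s => [|x s IH]; rewrite ?big_nil // big_cons; exact: Ng.
Qed.

Context (B : {biscalar V}).

Definition ext_contraction (x : V) : endo L :=
  mk_endo (let: And4 dL _ _ _ := left_contractionP B x in dL).

Lemma ext_contracts : contracts B ext_mul (1 : L) ext_contraction.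
Proof.
split=> [x|x y u]; have [_ d1 dg dM] := left_contractionP B x => //=.
by rewrite dM dg grade_involution_gen -ext_scalerAl mul1r mulNr.
Qed.

Lemma clifford_opE x u :
  clifford_op B x u = deformed_op ext_mul ext_contraction 1 x u.
Proof. by rewrite deformed_opE scale1r addrC. Qed.

End ExteriorModule.

(** * Quantization and the isomorphism *)

Section Chevalley.
Context (R : comNzRingType) (V : lmodType R) (B : {biscalar V}).

Local Notation L := (exterior_alg V).
Local Notation C := (clifford_quadratic (fun x : V => B x x)).
Local Notation gen := (@clifford_gen R V (fun x : V => B x x)).
Local Notation mul := (@clifford_mul R V (fun x : V => B x x)).

(** Exterior multiplication by [x], transported to Cl(Q). *)
Definition quantized_op : V -> endo C :=
  deformed_op mul (@clifford_contraction _ _ B) (-1).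

Lemma quantized_op_linear a x y : quantized_op (a *: x + y) =
  endo_scalar C a * quantized_op x + quantized_op y.
Proof.
apply: endoP => u; rewrite /quantized_op.
rewrite (deformed_op_linear (@clifford_generates _ _ _) (clifford_contracts B)) //.
by move=> b {}x {}y {}u /=; rewrite clifford_gen_linear mulrDl -clifford_scalerAl.
Qed.

Lemma quantized_op_sqr x : quantized_op x * quantized_op x = 0.
Proof.
apply: endoP => u; 
rewrite -[LHS]/(quantized_op x (quantized_op x u)).
rewrite (deformed_op_sqr (@clifford_generates _ _ _) (clifford_contracts B)) /=.
by rewrite mulrA clifford_gen_sqr -clifford_scalerAl mul1r mulN1r scaleNr subrr.
Qed.

Definition quantization (u : L) : C :=
  exterior_lift (@endo_scalarC R C) quantized_op_linear u 1.

Lemma quantization_linear : linear quantization.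
Proof.
have f0 := quantized_op_sqr; move=> a u v.
by rewrite /quantization (exterior_liftD _ _ f0) (exterior_liftZ _ _ f0).
Qed.

Lemma quantization1 : quantization 1 = 1.
Proof. by rewrite /quantization (exterior_lift1 _ _ quantized_op_sqr). Qed.

Lemma quantizationM x u : quantization (ext_mul x u) = quantized_op x (quantization u).
Proof.
have f0 := quantized_op_sqr.
by rewrite /quantization (exterior_liftM _ _ f0) (exterior_lift_gen _ _ f0).
Qed.

(** The operators L_x deform the wedge by [1], and the quantized wedge deforms Clifford
    multiplication by [-1], so the two deformations cancel. *)
Lemma quantization_clifford_op x u :
  quantization (clifford_op B x u) = gen x * quantization u.
Proof.
rewrite clifford_opE -[1]opprK.
exact: (transport_deformed (@ext_generates _ _) (ext_contracts B)
  (@clifford_generates _ _ _) (clifford_contracts B) quantization_linear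
  quantization1 quantizationM).
Qed.

Lemma clifford_op_linear_arg a x y u : clifford_op B (a *: x + y) u =
  a *: clifford_op B x u + clifford_op B y u.
Proof.
rewrite !clifford_opE (deformed_op_linear (@ext_generates _ _) (ext_contracts B)) //.
by move=> b {}x {}y {}u /=; rewrite ext_gen_linear mulrDl -ext_scalerAl.
Qed.

Lemma clifford_op_sqr x u : clifford_op B x (clifford_op B x u) = B x x *: u.
Proof.
rewrite !clifford_opE.
rewrite (deformed_op_sqr (@ext_generates _ _) (ext_contracts B)) /= mul1r.
by rewrite mulrA ext_gen_sqr mul0r add0r.
Qed.

Definition chevalley_rep : C -> endo L := clifford_rep clifford_op_linear_arg.

(** The intertwining property propagates from the generators to Cl(Q); at [u = 1] it says
    that [quantization] recovers [c] from its operator, so that [chevalley_rep] is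
    injective. *)
Lemma quantization_chevalley_rep c u :
  quantization (chevalley_rep c u) = c * quantization u.
Proof.
have f2 := clifford_op_sqr; move: c u.
apply: (clifford_generates (N := [set c |
  forall u, quantization (chevalley_rep c u) = c * quantization u])).
- have qL := quantization_linear.
  split=> [|a c c' /= ec ec'] u.
    by rewrite mul0r (clifford_rep0_app _ f2) (linear_prop0 qL).
  rewrite (clifford_rep_linear_app _ f2) qL ec ec' mulrDl.
  by rewrite -clifford_scalerAl.
- by move=> u; rewrite /chevalley_rep (clifford_rep1 _ f2) mul1r.
move=> x c /= ec u.
rewrite (clifford_rep_gen_app _ f2).
by rewrite quantization_clifford_op ec mulrA.
Qed.

Lemma chevalley_rep_onto f : generated_subalgebra (range (clifford_op B)) f ->
  exists c, chevalley_rep c = f.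
Proof.
have f2 := clifford_op_sqr.
apply: (@smallest_sub _ _ _ [set f | exists c, chevalley_rep c = f]); last first.
  by move=> _ [x _ <-]; exists (gen x); exact: clifford_rep_gen.
split=> [||_ _ [c <-] [c' <-]].
- split=> [|a _ _ [c <-] [c' <-]].
    by exists 0; rewrite -(scale0r 0) /chevalley_rep (clifford_repZ _ f2) scale0r.
  exists (a *: c + c').
  by rewrite /chevalley_rep (clifford_repD _ f2) (clifford_repZ _ f2).
- by exists 1; exact: clifford_rep1.
by exists (c * c'); exact: clifford_repM.
Qed.

Lemma chevalley_rep_in c : chevalley_rep c \in in_clifford B.
Proof.
have f2 := clifford_op_sqr; apply/in_cliffordP.
have [[N0 NL] N1 NM] := generated_subalgebraP (range (clifford_op B)).
apply: (clifford_generates (N := [set c |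
  generated_subalgebra (range (clifford_op B)) (chevalley_rep c)])) => [||x {}c /= Nc] /=.
- split=> [|a c1 c2 /= Nc1 Nc2] /=.
    by rewrite -(scale0r 0) /chevalley_rep (clifford_repZ _ f2) scale0r.
  by rewrite /chevalley_rep (clifford_repD _ f2) (clifford_repZ _ f2); exact: NL.
- by rewrite /chevalley_rep (clifford_rep1 _ f2).
rewrite /chevalley_rep (clifford_repM _ f2) (clifford_rep_gen _ f2).
by apply: NM => //; apply: sub_gen_smallest; exists x.
Qed.

Definition clifford_iso (f : clifford_bilinear B) : C := quantization (val f 1).

(** This identifies [clifford_iso] as a left inverse of [chevalley_rep]; as
    [chevalley_rep] reaches all of Cl(B), it is also a right inverse. *)
Lemma clifford_isoK c (f : clifford_bilinear B) :
  chevalley_rep c = val f -> clifford_iso f = c.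
Proof.
by move=> cf; rewrite /clifford_iso -cf quantization_chevalley_rep
  quantization1 mulr1.
Qed.

Lemma clifford_isoP (f : clifford_bilinear B) :
  chevalley_rep (clifford_iso f) = val f.
Proof.
have [c cf] := chevalley_rep_onto (in_cliffordP _ _ (valP f)).
by rewrite (clifford_isoK cf).
Qed.

Lemma clifford_iso_linear : linear clifford_iso.
Proof. by move=> a f f'; rewrite /clifford_iso -quantization_linear. Qed.

Lemma clifford_iso_monoid : monoid_morphism clifford_iso.
Proof.
split=> [|f f']; first exact: quantization1.
rewrite -[LHS]/(quantization (val f (val f' 1))) -(clifford_isoP f).
by rewrite quantization_chevalley_rep.
Qed.

Lemma clifford_iso_bijective : bijective clifford_iso.
Proof.
exists (fun c => exist _ (chevalley_rep c) (chevalley_rep_in c)) => [f|c].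
  by apply: val_inj; exact: clifford_isoP.
exact: clifford_isoK.
Qed.

(** Both graded parts are spans of products of generators, and the isomorphism maps L_x to
    the class of x. *)
Lemma clifford_iso_part b :
  clifford_iso @` clifford_bilinear_part B b =
  clifford_quadratic_part (fun x : V => B x x) b.
Proof.
rewrite clifford_quadratic_partE image_span; last exact: clifford_iso_linear.
rewrite (image_parity_products _ _ clifford_iso_monoid).
have -> // : clifford_iso \o clifford_bilinear_gen B = gen.
by apply/funext => x; apply: clifford_isoK; exact: (clifford_rep_gen _ clifford_op_sqr).
Qed.

End Chevalley.

(* vectType R is the type of free R-modules of finite rank. *)
Theorem mainTheorem1 (R : comNzRingType) (V : vectType R) (B : {biscalar V}) :
  2%N \notin [pchar R] ->
  nondegenerate_bilinear B ->
  exists phi : clifford_bilinear B -> clifford_quadratic (fun x : V => B x x),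
    [/\ linear phi, monoid_morphism phi, bijective phi
      & forall b : bool, phi @` clifford_bilinear_part B b =
          clifford_quadratic_part (fun x : V => B x x) b].
Proof.
move=> _ _; exists (@clifford_iso R V B); split.
- exact: clifford_iso_linear.
- exact: clifford_iso_monoid.
- exact: clifford_iso_bijective.
- exact: clifford_iso_part.
Qed.
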